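(* Assume that for all integers $q\ge2$ and $k\ge2$, the numbers $\zeta(k,a/q)$ with $1\le a\le q$ and $\gcd(a,q)=1$ are linearly independent over $\mathbb{Q}$. Let $p,q$ be distinct primes and let $f$ be a rational-valued arithmetic function of period $pq$. Suppose there are distinct integers $k,l>1$ such that $L(k,f)=L(l,f)=0$. Then there exist rational numbers $c_1,c_2$ such that, for $\Re s>1$, \[ L(s,f)=\Big(c_1\big(1-\tfrac{p^k}{p^s}\big)\big(1-\tfrac{q^l}{q^s}\big)+c_2\big(1-\tfrac{p^l}{p^s}\big)\big(1-\tfrac{q^k}{q^s}\big)\Big)\zeta(s). \]
   Context: $L(s,f)=\sum_{n\ge1}f(n)n^{-s}$ for $\Re s>1$. $\zeta(s,x)=\sum_{n\ge0}(n+x)^{-s}$ is the Hurwitz zeta function, and $\zeta(s)$ is the Riemann zeta function. *)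

(* Defs.v *)
From HB Require Import structures.
From mathcomp Require Import all_boot all_order all_algebra.
From mathcomp Require Import all_classical all_reals all_analysis.
From mathcomp Require Import complex.

Set Implicit Arguments.
Unset Strict Implicit.
Unset Printing Implicit Defensive.

Import Order.TTheory GRing.Theory Num.Theory.
Import numFieldNormedType.Exports.

Local Open Scope ring_scope.
Local Open Scope complex_scope.
Local Open Scope classical_set_scope.

(* x ^ s for a real base x > 0: with s = a + ib,
   x ^ s = x ^ a * (cos (b ln x) + i sin (b ln x)). *)
Definition rpowc (R : realType) (x : R) (s : R[i]) : R[i] :=
  let: a +i* b := s in
  (x `^ a)%:C * (cos (b * ln x) +i* sin (b * ln x)).

(* \sum_(n >= 0) u n. The type R[i]^o is R[i] with the topology of its modulus.
   As always with limn, the value is meaningful only if the series converges;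
   below this is the case for 1 < Re s (and f bounded, x > 0). *)
Definition cseries (R : realType) (u : nat -> R[i]) : R[i] :=
  limn (series u : nat -> R[i]^o).

(* Arithmetic functions are indexed by the positive integers: the value at 0
   is never used, and the term of index n is the one of the integer n.+1. *)
Definition Lseries (R : realType) (s : R[i]) (f : nat -> R[i]) : R[i] :=
  cseries (fun n => f n.+1 * rpowc n.+1%:R (- s)).

Definition hurwitz_zeta (R : realType) (s : R[i]) (x : R) : R[i] :=
  cseries (fun n => rpowc (n%:R + x) (- s)).

Definition riemann_zeta (R : realType) (s : R[i]) : R[i] :=
  cseries (fun n => rpowc n.+1%:R (- s)).

(* Linear independence over the rationals of the family (v i) indexed by the
   members of r, which is meant to be duplicate-free. *)
Definition rat_lin_indep (R : realType) (I : eqType) (r : seq I)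
    (v : I -> R[i]) : Prop :=
  forall c : I -> rat, \sum_(i <- r) ratr (c i) * v i = 0 ->
  {in r, forall i, c i = 0}.

Definition hurwitz_lin_indep (R : realType) (k q : nat) : Prop :=
  rat_lin_indep [seq a <- index_iota 1 q.+1 | coprime a q]
    (fun a => hurwitz_zeta k%:R (a%:R / q%:R : R)).

(* Main.v *)
(* Write each n as m n' with m in the monoid generated by p and q and n' coprime
   to p q. Then L(k, f) is a combination of the sums of n'^-k over the residue
   classes of n' modulo p q, and their independence turns L(k, f) = 0 into
   f(a) + P_k(a) + Q_k(a) = 0 for all a coprime to p q. Here P_k collects the
   values f(p^j a) and depends on a modulo q only, and Q_k collects the rest and
   depends on a modulo p only. Subtracting the relations for k and l, the Chinese
   remainder theorem shows that P_k - P_l and Q_k - Q_l are constant, and then so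
   are P_k and Q_k; hence f(n) depends on gcd(n, p q) only. So L(s, f) / zeta(s)
   is a bilinear form in X = p^-s and Y = q^-s vanishing at (p^-k, q^-k) and
   (p^-l, q^-l), and such forms make up a two-dimensional space. *)
Require Import Defs.
From HB Require Import structures.
From mathcomp Require Import all_boot all_order all_algebra.
From mathcomp Require Import all_classical all_reals all_analysis.
From mathcomp Require cyclic.
From mathcomp Require Import complex ring lra zify.

Set Implicit Arguments.
Unset Strict Implicit.
Unset Printing Implicit Defensive.

Import Order.TTheory GRing.Theory Num.Theory.
Import numFieldNormedType.Exports.

Local Open Scope ring_scope.
Local Open Scope complex_scope.

(** * Convergence of complex series, and complex powers of positive reals *)

Section DirichletSeries.
Context {R : realType}.
Implicit Types (x y t : R) (s z : R[i]) (g : nat -> R[i]).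

(* The tangent line bound for [t |-> (1 - 1/(x + 1)) `^ (- t)]; summing it
   over integers [x] telescopes. *)
Lemma powR_telescope x t : 0 < x -> 0 <= t ->
  t * (x + 1) `^ (- (t + 1)) <= x `^ (- t) - (x + 1) `^ (- t).
Proof.
move=> x0 t0; have y0 : 0 < x + 1 by rewrite addr_gt0.
have [v0 u0] : 0 < (x + 1)^-1 /\ 0 < 1 + - (x + 1)^-1.
  rewrite invr_gt0 y0; split=> //.
  by rewrite subr_gt0 invf_lt1// ltrDr.
have xE : x = (x + 1) * (1 + - (x + 1)^-1) by field; rewrite gt_eqF.
rewrite [in X in X - _]xE (powRM _ (ltW y0) (ltW u0)) opprD powRD; last first.
  by apply/implyP=> _; rewrite gt_eqF.
rewrite (powR_inv1 (ltW y0)) mulrCA -[X in _ - X]mulr1 -mulrBr.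
rewrite ler_pM2l ?powR_gt0// lerBrDl.
(* The remaining bound [1 + t / (x + 1) <= (1 - 1 / (x + 1)) ^ (- t)] follows from [exp y >= 1 + y]
   and [ln (1 + y) <= y]. *)
rewrite /powR gt_eqF//; apply: le_trans (expR_ge1Dx _).
rewrite lerD2l mulNr -mulrN ler_wpM2l// lerNr.
by apply: le_ln1Dx; rewrite ltrN2 invf_lt1// ltrDr.
Qed.

Lemma cvg_pseries x : 1 < x ->
  cvgn (series (fun n => n.+1%:R `^ (- x) : R)).
Proof.
move=> x1; set u := fun n => _; have t0 : 0 < x - 1 by rewrite subr_gt0.
have u0 n : 0 <= u n by rewrite powR_ge0.
apply: nondecreasing_is_cvgn.
  by apply: nondecreasing_series => n _.
(* Equality holds at [n = 0]; each later term is absorbed by [powR_telescope] with exponent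
   [x - 1]. *)
have bound n : (x - 1) * series u n.+1 <= x - n.+1%:R `^ (- (x - 1)).
  elim: n => [|n IHn]; rewrite seriesEnat /=.
    by rewrite big_nat1 /u ?mulr1n !powR1 mulr1.
  rewrite big_nat_recr//= mulrDr; rewrite seriesEnat /= in IHn.
  have := powR_telescope (ltr0Sn R n) (ltW t0); rewrite subrK natr1.
  rewrite /u in IHn *; lra.
exists (x / (x - 1)) => _ [n _ <-].
apply: (@le_trans _ _ (series u n.+1)).
  by rewrite seriesEnat /= big_nat_recr//= lerDl.
rewrite ler_pdivlMr// mulrC (le_trans (bound n))// gerBl.
exact: powR_ge0.
Qed.

Lemma cvg_complex (u : nat -> R[i]) (a b : R) :
  ((fun n => complex.Re (u n)) @ \oo --> a)%classic ->
  ((fun n => complex.Im (u n)) @ \oo --> b)%classic ->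
  ((u : nat -> R[i]^o) @ \oo --> (a +i* b : R[i]^o))%classic.
Proof.
move=> /cvgrPdist_lt ua /cvgrPdist_lt ub; apply/cvgrPdist_lt => e.
(* A positive element of [R[i]] is real, so [e] is its own real part. *)
rewrite ltcE => /andP[/eqP eI eR]; simpl in *.
have e20 : 0 < complex.Re e / 2 by rewrite divr_gt0.
near=> n.
have /= ha : `|a - complex.Re (u n)| < complex.Re e / 2 by near: n; exact: ua.
have /= hb : `|b - complex.Im (u n)| < complex.Re e / 2 by near: n; exact: ub.
have normR (c : R) : `|c%:C| = `|c|%:C.
  by rewrite normc_def /= expr0n /= addr0 sqrtr_sqr.
rewrite [X in `|X|]complexE (le_lt_trans (ler_normD _ _))//.
rewrite normrM !normR [X in X * _]normc_def /= expr0n expr1n add0r sqrtr1 mul1r.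
rewrite -rmorphD ltcE /= eI eqxx /=; move: ha hb.
case: (u n) => x y /=; lra.
Unshelve. all: by end_near. Qed.

(** Real and imaginary parts are bounded by the modulus, so the real comparison test applies to
    each. *)
Lemma is_cvg_cseries (v : nat -> R[i]) (w : nat -> R) :
  (forall n, `|v n| <= (w n)%:C) -> cvgn (series w) ->
  cvgn (series v : nat -> R[i]^o).
Proof.
move=> vw cw.
have ReE n : complex.Re (series v n) = series (fun i => complex.Re (v i)) n.
  elim: n => [|n IHn]; first by rewrite !seriesEnat /= !big_geq.
  rewrite !seriesSr -IHn; by case: (series v n) (v n) => ? ? [].
have ImE n : complex.Im (series v n) = series (fun i => complex.Im (v i)) n.
  elim: n => [|n IHn]; first by rewrite !seriesEnat /= !big_geq.
  rewrite !seriesSr -IHn; by case: (series v n) (v n) => ? ? [].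
have vRe n : `|complex.Re (v n)| <= w n.
  by rewrite -lecR (le_trans (normc_ge_Re _)).
have vIm n : `|complex.Im (v n)| <= w n.
  rewrite -lecR -normrN -ReiNIm (le_trans (normc_ge_Re _))//.
  by rewrite normrM [X in _ * X]normc_def /= expr0n expr1n add0r sqrtr1 mulr1.
have w0 n : 0 <= w n by apply: le_trans (vRe n).
have cmp (r : nat -> R) : (forall n, `|r n| <= w n) -> cvgn (series r).
  move=> rw; apply: normed_cvg; exact: series_le_cvg _ w0 rw cw.
apply/cvg_ex; eexists; apply: cvg_complex.
- by rewrite (funext ReE); apply: cmp vRe.
- by rewrite (funext ImE); apply: cmp vIm.
Qed.

Lemma cseriesD (u v : nat -> R[i]) :
  cvgn (series u : nat -> R[i]^o) -> cvgn (series v : nat -> R[i]^o) ->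
  cseries (fun n => u n + v n) = cseries u + cseries v.
Proof. exact: (@lim_seriesD R[i]). Qed.

Lemma cseriesZ (u : nat -> R[i]) (c : R[i]) :
  cvgn (series u : nat -> R[i]^o) ->
  cseries (fun n => c * u n) = c * cseries u.
Proof. exact: (@lim_seriesZ R[i]). Qed.

Lemma cseries_sum (I : Type) (r : seq I) (u : I -> nat -> R[i]) :
  (forall i, cvgn (series (u i) : nat -> R[i]^o)) ->
  cseries (fun n => \sum_(i <- r) u i n) = \sum_(i <- r) cseries (u i).
Proof.
move=> cu; apply: (@norm_cvg_lim _ R[i]^o).
rewrite [X in (X @ _)%classic](_ : _ = fun n => \sum_(i <- r) series (u i) n).
  by apply: cvg_big => [|i _]; [exact: add_continuous|exact: cu].
by apply/funext => n; rewrite exchange_big.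
Qed.

(** Serves to sum a series in blocks of length [d]: the partial sums of [v] are a subsequence of
    those of [u]. *)
Lemma cseries_subseq d (u v : nat -> R[i]) : (0 < d)%N ->
  cvgn (series u : nat -> R[i]^o) ->
  (forall n, series v n = series u (d * n)%N) -> cseries v = cseries u.
Proof.
move=> d0 cu vu; apply: (@norm_cvg_lim _ R[i]^o); rewrite (funext vu).
exact: (@cvg_comp _ _ _ (muln d) (series u : nat -> R[i]^o) _ _ _
  (@cvg_mulnl d d0) cu).
Qed.

Lemma rpowcN x s : 0 < x -> rpowc x (- s) = (rpowc x s)^-1.
Proof.
move=> x0; apply/esym/mulr1_eq; case: s => a b.
rewrite /rpowc /= mulrACA -rmorphM -powRD ?subrr ?powRr0 ?mul1r; last first.
  by apply/implyP => _; rewrite gt_eqF.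
rewrite mulNr cosN sinN; congr (_ +i* _) => /=; last by ring.
rewrite -[RHS](cos2Dsin2 (b * ln x)); ring.
Qed.

Lemma rpowcM x y s : 0 < x -> 0 < y -> rpowc (x * y) s = rpowc x s * rpowc y s.
Proof.
move=> x0 y0; case: s => a b.
rewrite /rpowc /= mulrACA -rmorphM -powRM ?ltW// lnM ?posrE// mulrDr cosD sinD.
by congr (_ * (_ +i* _)); rewrite /= addrC.
Qed.

Lemma rpowc_nat x k : 0 < x -> rpowc x k%:R = x%:C ^+ k.
Proof.
move=> x0; rewrite -[k%:R](rmorph_nat (real_complex R)) /= mul0r cos0 sin0.
by rewrite mulr1 powR_mulrn ?ltW// -rmorphXn.
Qed.

Lemma normr_rpowc x s : `|rpowc x s| = (x `^ complex.Re s)%:C.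
Proof.
case: s => a b; rewrite normrM !normc_def /= cos2Dsin2 sqrtr1 mulr1.
by rewrite expr0n addr0 sqrtr_sqr ger0_norm ?powR_ge0.
Qed.

Lemma rpowc_neq0 x s : 0 < x -> rpowc x s != 0.
Proof. by move=> x0; rewrite -normr_gt0 normr_rpowc ltcR powR_gt0. Qed.

End DirichletSeries.

(** * L-series with bounded coefficients, and Hurwitz zeta values *)

Section Lseries.
Context {R : realType}.
Implicit Types (x y t : R) (s z : R[i]) (g h : nat -> R[i]).

Definition bounded_seq g := exists M : R, forall n, `|g n| <= M%:C.

Lemma bounded_seq_periodic N g : (0 < N)%N ->
  (forall n, g (n + N)%N = g n) -> bounded_seq g.
Proof.
(* The bound is the sum of the moduli over one period; [complex.Re] brings them from [R[i]] to
   [R]. *)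
move=> N0 gN; exists (\sum_(i < N) complex.Re `|g i|) => n.
have -> : g n = g (n %% N)%N.
  rewrite {1}(divn_eq n N); elim: (n %/ N)%N => [|m IHm]; first by rewrite add0n.
  by rewrite mulSn -addnA addnC gN.
rewrite rmorph_sum /= (bigD1 (Ordinal (ltn_pmod n N0)))//=.
have ReK z : (complex.Re `|z|)%:C = `|z| by rewrite RRe_real// normr_real.
by rewrite ReK lerDl sumr_ge0// => i _; rewrite ReK.
Qed.

Lemma bounded_seqD g h : bounded_seq g -> bounded_seq h ->
  bounded_seq (fun n => g n + h n).
Proof.
move=> [M gM] [M' hM']; exists (M + M') => n.
by rewrite rmorphD /= (le_trans (ler_normD _ _))// lerD.
Qed.

Lemma bounded_seq_if (b : nat -> bool) g : bounded_seq g ->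
  bounded_seq (fun n => if b n then g n else 0).
Proof.
move=> [M gM]; exists M => n; case: ifP => _ //.
by rewrite normr0 (le_trans _ (gM n)).
Qed.

Lemma is_cvg_Lseries s g : 1 < complex.Re s -> bounded_seq g ->
  cvgn (series (fun n => g n.+1 * rpowc n.+1%:R (- s)) : nat -> R[i]^o).
Proof.
move=> s1 [M gM].
apply: (@is_cvg_cseries _ _ (fun n => M * n.+1%:R `^ (- complex.Re s))).
  move=> n; rewrite normrM normr_rpowc rmorphM /=.
  rewrite (_ : complex.Re (- s) = - complex.Re s); last by case: (s).
  by rewrite ler_wpM2r// lecR powR_ge0.
exact: (@is_cvg_seriesZ _ _ M (cvg_pseries s1)).
Qed.

(** As [x <= 1], [x * (n + 1) <= n + x], so a multiple of [(n + 1) ^ (- Re s)] dominates the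
    terms. *)
Lemma is_cvg_hurwitz_zeta s x : 1 < complex.Re s -> 0 < x -> x <= 1 ->
  cvgn (series (fun n => rpowc (n%:R + x) (- s)) : nat -> R[i]^o).
Proof.
move=> s1 x0 x1; have n0 n : 0 < n%:R + x by rewrite ltr_wpDl.
apply: (@is_cvg_cseries _ _
  (fun n => x `^ (- complex.Re s) * n.+1%:R `^ (- complex.Re s))).
  move=> n; rewrite normr_rpowc lecR -(powRM _ (ltW x0) (ler0n _ _)).
  rewrite (_ : complex.Re (- s) = - complex.Re s); last by case: (s).
  rewrite !powRN lef_pV2 ?posrE ?powR_gt0 ?mulr_gt0//.
  apply: ge0_ler_powR; rewrite ?nnegrE ?(ltW (n0 n)) ?mulr_ge0 ?(ltW x0)//.
    by apply: le_trans (ltW s1).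
  by rewrite -natr1 mulrDr mulr1 lerD2r ler_piMl.
exact: (@is_cvg_seriesZ _ _ _ (cvg_pseries s1)).
Qed.

Lemma LseriesD s g h : 1 < complex.Re s -> bounded_seq g -> bounded_seq h ->
  Lseries s (fun n => g n + h n) = Lseries s g + Lseries s h.
Proof.
move=> s1 bg bh; rewrite /Lseries -cseriesD; try exact: is_cvg_Lseries.
by congr cseries; apply/funext => n; rewrite mulrDl.
Qed.

Lemma LseriesZ s g (c : R[i]) : 1 < complex.Re s -> bounded_seq g ->
  Lseries s (fun n => c * g n) = c * Lseries s g.
Proof.
move=> s1 bg; rewrite /Lseries -cseriesZ; last exact: is_cvg_Lseries.
by congr cseries; apply/funext => n; rewrite mulrA.
Qed.

Lemma Lseries_multiples s g d : 1 < complex.Re s -> (0 < d)%N ->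
  bounded_seq g ->
  Lseries s (fun n => if (d %| n)%N then g n else 0) =
  rpowc d%:R (- s) * Lseries s (fun n => g (d * n)%N).
Proof.
move=> s1 d0 bg; rewrite /Lseries -cseriesZ; last first.
  apply: (is_cvg_Lseries (g := fun n => g (d * n)%N) s1).
  by have [M gM] := bg; exists M => n; exact: gM.
symmetry; apply: (cseries_subseq d0).
  exact: is_cvg_Lseries s1 (bounded_seq_if (fun n => d %| n)%N bg).
elim=> [|n IHn]; first by rewrite muln0 !seriesEnat /= !big_geq.
(* Index [i] stands for the integer [i + 1]: the block holds [d n + 1, ..., d n + d], whose only
   multiple of [d] is the last. *)
rewrite seriesSr IHn mulnS series_addn; congr (_ + _).
case: d d0 {IHn} => // d _; rewrite addSn big_nat_recr ?leq_addl//=.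
rewrite big_nat_cond big1 ?add0r => [|i /andP[/andP[i1 i2] _]]; last first.
  rewrite ifF ?mul0r//; apply/negP => /dvdnP[j jE].
  have nj : (n < j)%N by rewrite -(@ltn_pmul2r d.+1)// -jE mulnC ltnS.
  by have := leq_mul2r d.+1 n.+1 j; rewrite nj orbT -jE; lia.
have nE : (d + d.+1 * n).+1 = (d.+1 * n.+1)%N by lia.
by rewrite nE dvdn_mulr// natrM rpowcM ?ltr0Sn// mulrCA mulrA.
Qed.

(** For [n = a + N m], [n ^ (- s) = N ^ (- s) * (m + a / N) ^ (- s)]. Letting [a] run from [1] to
    [N] keeps [a / N] positive. *)
Lemma Lseries_hurwitz s g N : 1 < complex.Re s -> (0 < N)%N ->
  (forall n, g (n + N)%N = g n) ->
  Lseries s g = rpowc N%:R (- s) *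
    \sum_(1 <= a < N.+1) g a * hurwitz_zeta s (a%:R / N%:R).
Proof.
move=> s1 N0 gN; have N0' : 0 < N%:R :> R by rewrite ltr0n.
have cH i : (i < N)%N ->
  cvgn (series (fun n => rpowc (n%:R + i.+1%:R / N%:R : R) (- s)) : nat -> R[i]^o).
  move=> iN; apply: is_cvg_hurwitz_zeta => //; first by rewrite divr_gt0.
  by rewrite ler_pdivrMr// mul1r ler_nat.
rewrite big_add1 big_mkord mulr_sumr.
under eq_bigr => i _.
  rewrite /hurwitz_zeta mulrA -cseriesZ; last exact: cH (ltn_ord i).
  over.
rewrite -cseries_sum; last first.
  by move=> i; exact: (@is_cvg_seriesZ R[i] _ _ (cH _ (ltn_ord i))).
symmetry; apply: (cseries_subseq N0).
  by apply: (is_cvg_Lseries s1); exact: bounded_seq_periodic gN.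
elim=> [|n IHn]; first by rewrite muln0 !seriesEnat /= !big_geq.
rewrite seriesSr IHn mulnS series_addn; congr (_ + _).
rewrite -{1}[(N * n)%N]add0n big_addn addnK big_mkord; apply: eq_bigr => i _.
have -> : g (i + N * n).+1 = g i.+1.
  rewrite -addSn; elim: (n) => [|m IHm]; first by rewrite muln0 addn0.
  by rewrite mulnS addnCA addnC gN.
rewrite -mulrA mulrCA -rpowcM//; last first.
  by rewrite ltr_wpDl// divr_gt0.
congr (_ * rpowc _ _).
rewrite mulrDr mulrCA mulfV ?gt_eqF// mulr1 -natrM -natrD; congr _%:R.
by rewrite addnS addnC.
Qed.

Lemma riemann_zetaE s : riemann_zeta s = Lseries s (fun=> 1).
Proof. by congr cseries; apply/funext => n; rewrite mul1r. Qed.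

End Lseries.

(** * Sieving by [p] and [q] down to the residues coprime to [p q] *)

(** Split [L(s, g) + L(s, P)] by divisibility by [d]. The multiples contribute [d ^ (- s)] times the
    series of [(g + P)(d n) = d ^ s P n], that is [L(s, P)], which cancels. *)
Lemma Lseries_sieve (R : realType) (s : R[i]) (d : nat) (g P : nat -> R[i]) :
  1 < complex.Re s -> (0 < d)%N -> bounded_seq g -> bounded_seq P ->
  (forall n, rpowc d%:R s * P n = g (d * n)%N + P (d * n)%N) ->
  Lseries s (fun n => if (d %| n)%N then 0 else g n + P n) = Lseries s g.
Proof.
move=> s1 d0 bg bP PE; pose u n := g n + P n.
have bu : bounded_seq u by exact: bounded_seqD.
have := LseriesD s1 (bounded_seq_if (fun n => ~~ (d %| n))%N bu)
  (bounded_seq_if (fun n => d %| n)%N bu).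
rewrite (_ : (fun n => _ + _) = u); last first.
  by apply/funext => n; case: (d %| n)%N; rewrite /= ?add0r ?addr0.
rewrite (_ : (fun n => if ~~ _ then _ else _) =
  (fun n => if (d %| n)%N then 0 else u n)); last first.
  by apply/funext => n; case: (d %| n)%N.
rewrite Lseries_multiples// rpowcN ?ltr0n//.
rewrite (_ : (fun n => u (d * n)%N) = (fun n => rpowc d%:R s * P n)); last first.
  by apply/funext => n; rewrite PE.
rewrite LseriesZ// mulKf ?rpowc_neq0 ?ltr0n//.
by rewrite /u LseriesD// => /addIr ->.
Qed.

(* [P n = \sum_(j >= 1) d ^ (- k j) * g (d ^ j * n)]; as [g (d ^ j * n)] has
   period [e] in [j], this resums to a finite rational expression. *)
Lemma sieve_equation_solvable (d e k : nat) (g : nat -> rat) :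
  (1 < d)%N -> (0 < k)%N -> (0 < e)%N ->
  (forall n, g (d ^ e * (d * n))%N = g (d * n)%N) ->
  exists P : nat -> rat,
    (forall n, d%:R ^+ k * P n = g (d * n)%N + P (d * n)%N) /\
    (forall m n, (forall j, g (d ^ j.+1 * m)%N = g (d ^ j.+1 * n)%N) ->
      P m = P n).
Proof.
move=> d1 k0 e0 ge; pose x : rat := (d%:R ^+ k)^-1.
have x1 : 1 < d%:R ^+ k :> rat by rewrite exprn_egt1 ?ltr1n// gt_eqF.
have xe : 1 - x ^+ e != 0.
  rewrite subr_eq0 gt_eqF// exprn_ilt1 ?invr_ge0 ?exprn_ge0 -?lt0n// invf_lt1//.
  exact: lt_trans x1.
exists (fun n => (\sum_(j < e) x ^+ j.+1 * g (d ^ j.+1 * n)%N) / (1 - x ^+ e)).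
split=> [n|m n gmn]; last by congr (_ / _); apply: eq_bigr => j _; rewrite gmn.
rewrite mulrA mulr_sumr -[g (d * n)%N](mulfK xe) -mulrDl; congr (_ / _).
under eq_bigr do rewrite exprS mulrA mulrA mulfV ?gt_eqF ?(lt_trans _ x1)// mul1r.
under [in RHS]eq_bigr do rewrite mulnA -expnSr.
(* Up to the denominator, the left side sums [F j] and [P (d n)] sums [F (j + 1)], so their
   difference telescopes to [F 0 - F e]. *)
pose F j := x ^+ j * g (d ^ j.+1 * n)%N.
rewrite -(big_mkord xpredT F) -(big_mkord xpredT (fun j => F j.+1)).
have F0 : F 0%N = g (d * n)%N by rewrite /F expr0 mul1r expn1.
have Fe : F e = x ^+ e * g (d * n)%N by rewrite /F expnSr -mulnA ge.
have := telescope_sumr F (leq0n e); rewrite sumrB F0 Fe => tE.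
by rewrite mulrBr mulr1 mulrC; lra.
Qed.

Lemma eq_modn_mulr d M m n : m = n %[mod M] -> d * m = d * n %[mod d * M].
Proof. by move=> mn; rewrite -!muln_modr mn. Qed.


(* The Hurwitz values at level [p * q] are only known to be independent for
   numerators coprime to [p * q]; summing over all powers of [p] and then of
   [q] moves the whole of [L(k, f)] to these numerators. *)
Lemma Lseries_eq0_units (R : realType) (p q k : nat) (f : nat -> rat) :
  hurwitz_lin_indep R k (p * q) ->
  prime p -> prime q -> p <> q -> (1 < k)%N ->
  (forall m n, m = n %[mod p * q] -> f m = f n) ->
  Lseries (k%:R : R[i]) (fun n => ratr (f n)) = 0 ->
  exists P Q : nat -> rat,
    [/\ forall n, p%:R ^+ k * P n = f (p * n)%N + P (p * n)%N,
        forall m n, m = n %[mod q] -> P m = P n,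
        forall n, ~~ (p %| n)%N ->
          q%:R ^+ k * Q n = f (q * n)%N + P 0%N + Q (q * n)%N,
        forall m n, m = n %[mod p] -> Q m = Q n &
        forall n, coprime n (p * q) -> f n + P n + Q n = 0].
Proof.
move=> indep hp hq pq k1 fper L0.
have [p0 q0] := (prime_gt0 hp, prime_gt0 hq).
have [p1 q1] := (prime_gt1 hp, prime_gt1 hq).
have k0 : (0 < k)%N by exact: ltnW.
have N0 : (0 < p * q)%N by rewrite muln_gt0 p0.
have cpq : coprime p q by rewrite prime_coprime// dvdn_prime2//; apply/eqP.
have ReK : 1 < complex.Re (k%:R : R[i]).
  by rewrite -[k%:R](rmorph_nat (real_complex R)) /= ltr1n.
have bper (g : nat -> rat) : (forall m n, m = n %[mod p * q] -> g m = g n) ->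
    bounded_seq (fun n => ratr (g n) : R[i]).
  move=> gper; apply: (bounded_seq_periodic N0) => n.
  by rewrite (gper _ n)// modnDr.
have rE (d : nat) : (0 < d)%N -> rpowc d%:R k%:R = ratr (d%:R ^+ k) :> R[i].
  by move=> d0; rewrite rpowc_nat ?ltr0n// !rmorphXn /= !rmorph_nat.
(* By Euler's theorem the sequence [a n, a ^ 2 n, ...] modulo [a b] has period [totient b] from its
   first term on. *)
have euler a b n : coprime a b ->
    a ^ totient b * (a * n) = a * n %[mod a * b].
  move=> ab; rewrite mulnCA; apply: eq_modn_mulr.
  by rewrite -modnMml cyclic.Euler_exp_totient// modnMml mul1n.
have [P [PE Pper]] : exists P : nat -> rat,
    (forall n, p%:R ^+ k * P n = f (p * n)%N + P (p * n)%N) /\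
    (forall m n, (forall j, f (p ^ j.+1 * m)%N = f (p ^ j.+1 * n)%N) ->
      P m = P n).
  apply: (sieve_equation_solvable p1 k0 (e := totient q)).
    by rewrite totient_gt0.
  by move=> n; apply: fper; exact: euler.
(* [p ^ j.+1 * n] modulo [p * q] depends only on [n] modulo [q]. *)
have Pq m n : m = n %[mod q] -> P m = P n.
  move=> mn; apply: Pper => j; apply: fper; rewrite expnS -!mulnA.
  by apply: eq_modn_mulr; rewrite -modnMmr mn modnMmr.
have modq m n : m = n %[mod p * q] -> m = n %[mod q].
  by move=> mn; rewrite -(modn_dvdm m (dvdn_mull p (dvdnn q))) mn modn_dvdm ?dvdn_mull.
have modp m n : m = n %[mod p * q] -> m = n %[mod p].
  by move=> mn; rewrite -(modn_dvdm m (dvdn_mulr q (dvdnn p))) mn modn_dvdm ?dvdn_mulr.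
(* First sieve: [h] vanishes on the multiples of [p], and [L(k, h) = L(k, f)]. *)
pose h n := if (p %| n)%N then 0 else f n + P n.
have hper m n : m = n %[mod p * q] -> h m = h n.
  move=> mn; rewrite /h (fper _ _ mn) (Pq _ _ (modq _ _ mn)).
  by rewrite /dvdn (modp _ _ mn).
have Lh : Lseries (k%:R : R[i]) (fun n => ratr (h n)) = 0.
  rewrite -[RHS]L0 -[RHS](@Lseries_sieve _ _ p _ (fun n => ratr (P n)))//.
  - congr Lseries; apply/funext => n; rewrite /h.
    by case: ifP => _; rewrite ?rmorph0 ?rmorphD.
  - exact: bper.
  - by apply: bper => m n /modq /Pq.
  - by move=> n; rewrite rE// -rmorphM PE rmorphD.
have [Q [QE Qper]] : exists Q : nat -> rat,
    (forall n, q%:R ^+ k * Q n = h (q * n)%N + Q (q * n)%N) /\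
    (forall m n, (forall j, h (q ^ j.+1 * m)%N = h (q ^ j.+1 * n)%N) ->
      Q m = Q n).
  apply: (sieve_equation_solvable q1 k0 (e := totient p)).
    by rewrite totient_gt0.
  move=> n; apply: hper; rewrite [in X in _ = _ %[mod X]]mulnC.
  by apply: euler; rewrite coprime_sym.
have Qp m n : m = n %[mod p] -> Q m = Q n.
  move=> mn; apply: Qper => j; apply: hper; rewrite expnS -!mulnA.
  rewrite [in X in _ = _ %[mod X]]mulnC.
  by apply: eq_modn_mulr; rewrite -modnMmr mn modnMmr.
(* Second sieve, by [q]: [g] turns out to be supported on the integers coprime to [p q]. *)
pose g n := if (q %| n)%N then 0 else h n + Q n.
have gper m n : m = n %[mod p * q] -> g m = g n.
  move=> mn; rewrite /g (hper _ _ mn) (Qp _ _ (modp _ _ mn)).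
  by rewrite /dvdn (modq _ _ mn).
have Lg : Lseries (k%:R : R[i]) (fun n => ratr (g n)) = 0.
  rewrite -[RHS]Lh -[RHS](@Lseries_sieve _ _ q _ (fun n => ratr (Q n)))//.
  - congr Lseries; apply/funext => n; rewrite /g.
    by case: ifP => _; rewrite ?rmorph0 ?rmorphD.
  - exact: bper.
  - by apply: bper => m n /modp /Qp.
  - by move=> n; rewrite rE// -rmorphM QE rmorphD.
have h0 n : (p %| n)%N -> h n = 0 by rewrite /h => ->.
(* Here [Q n = Q 0], and since [h 0 = 0] the equation at [0] reads [q ^ k * Q 0 = Q 0]. *)
have Q0 n : (p %| n)%N -> Q n = 0.
  move=> pn; rewrite (Qp n 0%N); last by rewrite mod0n; exact/eqP.
  have /eqP := QE 0%N; rewrite muln0 h0// add0r -subr_eq0 -{2}[Q _]mul1r -mulrBl.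
  rewrite mulf_eq0 => /orP[|/eqP//].
  by rewrite subr_eq0 gt_eqF// exprn_egt1 ?ltr1n// -lt0n.
have gunit n : ~~ coprime n (p * q) -> g n = 0.
  rewrite coprimeMr negb_and ![coprime n _]coprime_sym !prime_coprime// !negbK.
  by rewrite /g; case: ifP => //= _; rewrite orbF => pn; rewrite h0// Q0// addr0.
(* Only numerators coprime to [p q] survive when [L(k, g) = 0] is expanded in Hurwitz values, so
   independence applies. *)
have g0 n : coprime n (p * q) -> g n = 0.
  move=> cn; rewrite (gper n (n %% (p * q))%N) ?modn_mod//.
  have rgper m : ratr (g (m + p * q)%N) = ratr (g m) :> R[i].
    by rewrite (gper _ m)// modnDr.
  have := Lseries_hurwitz ReK N0 rgper; rewrite Lg => /esym/eqP.
  rewrite mulf_eq0 (negPf (rpowc_neq0 _ _)) ?ltr0n//= => /eqP sum0.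
  apply: (indep g); last first.
    rewrite mem_filter coprime_modl cn mem_index_iota /= ltnS; apply/andP.
    split; last exact: ltnW (ltn_pmod _ N0).
    rewrite lt0n; apply: contraTneq cn => n0; rewrite -coprime_modl n0 /coprime gcd0n.
    by rewrite gtn_eqF// (leq_trans p1)// leq_pmulr.
  rewrite big_filter -[RHS]sum0 [RHS](bigID (fun a => coprime a (p * q)))/=.
  rewrite [X in _ = _ + X]big1 ?addr0// => a /gunit ->.
  by rewrite rmorph0 mul0r.
have pE n : coprime n p = ~~ (p %| n)%N by rewrite coprime_sym prime_coprime.
have qE n : coprime n q = ~~ (q %| n)%N by rewrite coprime_sym prime_coprime.
exists P, Q; split=> //.
(* [q n] stays prime to [p], so [h (q n) = f (q n) + P (q n)], and [P (q n) = P 0] by periodicity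
   modulo [q]. *)
- move=> n pn; rewrite QE; congr (_ + _).
  rewrite /h Euclid_dvdM// dvdn_prime2// (negPf pn) orbF ifN; last exact/eqP.
  by congr (_ + _); apply: Pq; rewrite mod0n modnMr.
- move=> n cn; rewrite -[RHS](g0 n cn) /g /h.
  by move: cn; rewrite coprimeMr pE qE => /andP[/negPf -> /negPf ->].
Qed.

(** * Rigidity forced by two zeros *)

(** By the Chinese remainder theorem the residues modulo [p] and [q] vary independently, so
    [u b + v a = 0] for all units [b] modulo [q] and [a] modulo [p]. *)
Lemma const_on_units (p q : nat) (u v : nat -> rat) :
  coprime p q -> (0 < p)%N -> (0 < q)%N ->
  (forall m n, m = n %[mod q] -> u m = u n) ->
  (forall m n, m = n %[mod p] -> v m = v n) ->
  (forall n, coprime n (p * q) -> u n + v n = 0) ->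
  (forall n, coprime n q -> u n = u 1%N) /\
  (forall n, coprime n p -> v n = v 1%N).
Proof.
move=> cpq p0 q0 uq vp uv.
have cE a b : coprime (chinese p q a b) (p * q) = coprime a p && coprime b q.
  by rewrite coprimeMr -coprime_modl chinese_modl// coprime_modl
    -[X in _ && X]coprime_modl chinese_modr// coprime_modl.
have uvE a b : coprime a p -> coprime b q -> u b + v a = 0.
  move=> ca cb; rewrite -(uv (chinese p q a b)) ?cE ?ca//.
  congr (_ + _); [apply: uq|apply: vp].
    by rewrite chinese_modr.
  by rewrite chinese_modl.
have uv1 := uvE 1%N 1%N (coprime1n _) (coprime1n _).
split=> n cn.
  by apply: (addIr (v 1%N)); rewrite uvE ?coprime1n.
by apply: (addrI (u 1%N)); rewrite uvE ?coprime1n.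
Qed.

(** The determinant is [x - y]. Used with [x, y] the [k]-th and [l]-th powers of a prime and [a, b]
    the corrections attached to [k] and [l]. *)
Lemma linear_system_unique (F : fieldType) (x y a b a1 b1 : F) : x != y ->
  a - b = a1 - b1 -> x * a - y * b = x * a1 - y * b1 -> a = a1.
Proof.
rewrite -subr_eq0 => xy /eqP; rewrite -subr_eq0 => /eqP e1.
move=> /eqP; rewrite -subr_eq0 => /eqP e2.
apply/eqP; rewrite -subr_eq0 -[_ == 0](inj_eq (mulfI xy)) mulr0.
have -> : (x - y) * (a - a1) =
  (x * a - y * b - (x * a1 - y * b1)) - y * (a - b - (a1 - b1)) by ring.
by rewrite e1 e2 mulr0 subr0.
Qed.

(** The last clause spells out [(p q) ^ k * L(k, f) / zeta(k) = 0] for an [f] that depends on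
    [gcd(n, p q)] only. *)
Lemma Lseries_two_zeros (R : realType) (p q k l : nat) (f : nat -> rat) :
  hurwitz_lin_indep R k (p * q) -> hurwitz_lin_indep R l (p * q) ->
  prime p -> prime q -> p <> q -> (1 < k)%N -> (1 < l)%N -> k <> l ->
  (forall m n, m = n %[mod p * q] -> f m = f n) ->
  Lseries (k%:R : R[i]) (fun n => ratr (f n)) = 0 ->
  Lseries (l%:R : R[i]) (fun n => ratr (f n)) = 0 ->
  [/\ forall n, ~~ (q %| n)%N -> f (p * n)%N = f p,
      forall n, ~~ (p %| n)%N -> f (q * n)%N = f q,
      forall n, coprime n (p * q) -> f n = f 1%N &
      (p%:R ^+ k - 1) * (q%:R ^+ k - 1) * f 1%N + (q%:R ^+ k - 1) * f p
        + (p%:R ^+ k - 1) * f q + f 0%N = 0].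
Proof.
move=> ik il hp hq pq k1 l1 kl fper Lk Ll.
have [P [Q [PE Pq QE Qp PQ]]] := Lseries_eq0_units ik hp hq pq k1 fper Lk.
have [P' [Q' [PE' Pq' QE' Qp' PQ']]] :=
  Lseries_eq0_units il hp hq pq l1 fper Ll.
have cpq : coprime p q by rewrite prime_coprime// dvdn_prime2//; apply/eqP.
have pE n : coprime n p = ~~ (p %| n)%N by rewrite coprime_sym prime_coprime.
have qE n : coprime n q = ~~ (q %| n)%N by rewrite coprime_sym prime_coprime.
(* Subtracting the relations for [k] and [l] cancels [f n]. *)
have [uE vE] : (forall n, coprime n q -> P n - P' n = P 1%N - P' 1%N) /\
    (forall n, coprime n p -> Q n - Q' n = Q 1%N - Q' 1%N).
  apply: (const_on_units (u := fun n => P n - P' n) (v := fun n => Q n - Q' n)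
    cpq (prime_gt0 hp) (prime_gt0 hq)).
  - by move=> m n mn; rewrite (Pq _ _ mn) (Pq' _ _ mn).
  - by move=> m n mn; rewrite (Qp _ _ mn) (Qp' _ _ mn).
  - by move=> n cn; have := PQ n cn; have := PQ' n cn; lra.
have pow_neq (d : nat) : prime d -> d%:R ^+ k != d%:R ^+ l :> rat.
  by move=> /prime_gt1 d1; rewrite -!natrX eqr_nat eqn_exp2l//; apply/eqP.
(* The difference of the equations for [P] and [P'] is free of [f], so [p ^ k P - p ^ l P'] is
   constant on units, as is [P - P']. *)
have Pc n : coprime n q -> P n = P 1%N.
  move=> cn; have cpn : coprime (p * n) q by rewrite coprimeMl cpq.
  apply: (linear_system_unique (pow_neq p hp) (uE n cn)).
  have := uE _ cpn; have := uE p cpq.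
  by have := PE n; have := PE' n; have := PE 1%N; have := PE' 1%N; rewrite !muln1; lra.
have Qc n : coprime n p -> Q n = Q 1%N.
  have cqp : coprime q p by rewrite coprime_sym.
  move=> cn; have cqn : coprime (q * n) p by rewrite coprimeMl cqp.
  apply: (linear_system_unique (pow_neq q hq) (vE n cn)).
  have := vE _ cqn; have := vE q cqp; rewrite pE in cn.
  have c1 : ~~ (p %| 1)%N by rewrite -pE coprime1n.
  have := QE _ cn; have := QE' _ cn; have := QE _ c1; have := QE' _ c1.
  by rewrite !muln1; lra.
(* These equations express [f] at [0], [p], [q] and [1] through [P 0], [P 1] and [Q 1]; the last
   clause is an identity in the latter. *)
have P0 := PE 0%N; have P1 := PE 1%N; rewrite muln0 in P0; rewrite muln1 in P1.
have c1 : ~~ (p %| 1)%N by rewrite -pE coprime1n.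
have Q1 := QE _ c1; rewrite muln1 in Q1.
have Pp : P p = P 1%N by exact: Pc.
have Qq : Q q = Q 1%N by apply: Qc; rewrite coprime_sym.
have f1 := PQ 1%N (coprime1n _).
split=> [n|n|n|].
- rewrite -qE => cn; have := PE n; rewrite Pc// Pc ?coprimeMl ?cpq//; lra.
- rewrite -pE => cn; have := QE n; rewrite -pE => /(_ cn).
  rewrite Qc// Qc ?coprimeMl ?cn ?andbT; first by lra.
  by rewrite coprime_sym.
- move=> cn; have := PQ n cn; move: cn; rewrite coprimeMr => /andP[np nq].
  by rewrite Pc// Qc//; lra.
- have -> : f 0%N = p%:R ^+ k * P 0%N - P 0%N by lra.
  have -> : f p = p%:R ^+ k * P 1%N - P 1%N by lra.
  have -> : f q = q%:R ^+ k * Q 1%N - Q 1%N - P 0%N by lra.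
  have -> : f 1%N = - P 1%N - Q 1%N by lra.
  ring.
Qed.

(** * The explicit form of the L-series *)

(** A constant [c] on the multiples of [d] contributes [c * d ^ (- s) * zeta(s)]; here [d] is [1],
    [p], [q] and [p q]. *)
Lemma Lseries_gcd (R : realType) (s : R[i]) (p q : nat) (f : nat -> R[i])
    (c0 c1 c2 c3 : R[i]) :
  1 < complex.Re s -> (0 < p)%N -> (0 < q)%N ->
  (forall n, f n = c0 + (if (p %| n)%N then c1 else 0)
    + (if (q %| n)%N then c2 else 0) + (if (p * q %| n)%N then c3 else 0)) ->
  Lseries s f = (c0 + c1 / rpowc p%:R s + c2 / rpowc q%:R s
    + c3 / (rpowc p%:R s * rpowc q%:R s)) * riemann_zeta s.
Proof.
move=> s1 p0 q0 fE; rewrite (funext fE).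
have b1 (c : R[i]) : bounded_seq (fun=> c).
  by exists (complex.Re `|c|) => n; rewrite RRe_real ?normr_real.
have Lc (c : R[i]) : Lseries s (fun=> c) = c * riemann_zeta s.
  rewrite riemann_zetaE -LseriesZ//.
  by congr Lseries; apply/funext => n; rewrite mulr1.
have Lif d c : (0 < d)%N -> Lseries s (fun n => if (d %| n)%N then c else 0) =
    c / rpowc d%:R s * riemann_zeta s.
  move=> d0; rewrite (Lseries_multiples (g := fun=> c))// Lc rpowcN ?ltr0n//.
  by rewrite mulrA [_^-1 * _]mulrC.
have bd d c := bounded_seq_if (fun n => d %| n)%N (b1 c).
have bD1 := bounded_seqD (b1 c0) (bd p c1).
have bD2 := bounded_seqD bD1 (bd q c2).
rewrite (LseriesD s1 bD2 (bd (p * q)%N c3)) (LseriesD s1 bD1 (bd q c2)).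
rewrite (LseriesD s1 (b1 c0) (bd p c1)) Lc !Lif ?muln_gt0 ?p0//.
by rewrite natrM rpowcM ?ltr0n// !mulrDl.
Qed.

(* The hypotheses say that the form [a0 + a1 X + a2 Y + a3 X Y] vanishes at
   [(1/x, 1/y)] and [(1/z, 1/w)], the conclusion that it is a combination of
   [(1 - x X) (1 - w Y)] and [(1 - z X) (1 - y Y)]. *)
Lemma bilinear_two_zeros (F : fieldType) (x y z w a0 a1 a2 a3 : F) : x != z ->
  a0 * (x * y) + a1 * y + a2 * x + a3 = 0 ->
  a0 * (z * w) + a1 * w + a2 * z + a3 = 0 ->
  exists c1 c2, [/\ a0 = c1 + c2, a1 = - (c1 * x + c2 * z),
    a2 = - (c1 * w + c2 * y) & a3 = c1 * (x * w) + c2 * (z * y)].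
Proof.
move=> xz e1 e2; have zx : z - x != 0 by rewrite subr_eq0 eq_sym.
have a2E : a2 = (- a0 * (x * y - z * w) - a1 * (y - w)) / (x - z).
  apply: (canRL (mulfK _)); first by rewrite subr_eq0.
  apply/eqP; rewrite -subr_eq0; apply/eqP.
  rewrite -[RHS](subrr 0) -{1}e1 -e2; ring.
have a3E : a3 = - (a0 * (x * y) + a1 * y + a2 * x).
  by apply/eqP; rewrite -addr_eq0 addrC e1.
(* The witnesses solve the first two equations; the other two follow since [a2] and [a3] are
   determined by [a0], [a1] and the vanishing conditions. *)
exists ((a1 + a0 * z) / (z - x)), (a0 - (a1 + a0 * z) / (z - x)).
have xz' : x - z != 0 by rewrite subr_eq0.
by split; rewrite ?a3E ?a2E; field; rewrite ?zx ?xz'.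
Qed.
Theorem theorem1p11 (R : realType)
    (hindep : forall q k : nat, (2 <= q)%N -> (2 <= k)%N ->
       hurwitz_lin_indep R k q)
    (p q : nat) (hp : prime p) (hq : prime q) (hpq : p <> q)
    (f : nat -> rat)
    (hf : forall n : nat, (0 < n)%N -> f (n + p * q)%N = f n)
    (k l : nat) (hk : (1 < k)%N) (hl : (1 < l)%N) (hkl : k <> l)
    (hLk : Lseries (k%:R : R[i]) (fun n => ratr (f n)) = 0)
    (hLl : Lseries (l%:R : R[i]) (fun n => ratr (f n)) = 0) :
  exists c1 c2 : rat, forall s : R[i], 1 < complex.Re s ->
    Lseries s (fun n => ratr (f n)) =
    (ratr c1 * (1 - p%:R ^+ k / rpowc p%:R s) * (1 - q%:R ^+ l / rpowc q%:R s)
     + ratr c2 * (1 - p%:R ^+ l / rpowc p%:R s)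
               * (1 - q%:R ^+ k / rpowc q%:R s))
    * riemann_zeta s.
Proof.
have [p0 q0] := (prime_gt0 hp, prime_gt0 hq).
have [p1 q1] := (prime_gt1 hp, prime_gt1 hq).
have N0 : (0 < p * q)%N by rewrite muln_gt0 p0.
have N2 : (2 <= p * q)%N by rewrite (leq_trans p1)// leq_pmulr.
(* [f 0] is arbitrary, as periodicity is assumed from [1] on. [f'] is the fully periodic function
   agreeing with [f] on positive integers, with [f' 0 = f (p q)]. *)
pose f' n := f (n %% (p * q) + p * q)%N.
have f'per m n : m = n %[mod p * q] -> f' m = f' n by rewrite /f' => ->.
have f'E n : (0 < n)%N -> f' n = f n.
  move=> n0; rewrite -[RHS]hf// [in RHS](divn_eq n (p * q)).
  rewrite -addnA [in RHS]addnC.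
  rewrite /f'; elim: (n %/ (p * q))%N => [|m IHm]; first by rewrite mul0n addn0.
  by rewrite mulSn [(p * q + m * _)%N]addnC addnA [RHS]hf// !addn_gt0 N0 orbT.
have Lf' s : Lseries s (fun n => ratr (f n) : R[i]) =
    Lseries s (fun n => ratr (f' n)).
  by congr cseries; apply/funext => n; rewrite f'E.
rewrite !Lf' in hLk hLl.
have [fp fq f1 relk] := Lseries_two_zeros (hindep _ _ N2 hk) (hindep _ _ N2 hl)
  hp hq hpq hk hl hkl f'per hLk hLl.
(* Exchanging [k] and [l] gives the linear relation at [l]. *)
have [_ _ _ rell] := Lseries_two_zeros (hindep _ _ N2 hl) (hindep _ _ N2 hk)
  hp hq hpq hl hk (nesym hkl) f'per hLl hLk.
have cpq : coprime p q by rewrite prime_coprime// dvdn_prime2//; apply/eqP.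
(* Inclusion-exclusion over the four values of [gcd(n, p q)]. *)
pose a1 := f' p - f' 1%N; pose a2 := f' q - f' 1%N.
pose a3 := f' 0%N - f' p - f' q + f' 1%N.
have fE n : f' n = f' 1%N + (if (p %| n)%N then a1 else 0)
    + (if (q %| n)%N then a2 else 0) + (if (p * q %| n)%N then a3 else 0).
  rewrite Gauss_dvd// /a1 /a2 /a3.
  have [pn|pn] := boolP (p %| n)%N; have [qn|qn] := boolP (q %| n)%N => /=.
  - rewrite (f'per n 0%N); first by ring.
    by rewrite mod0n; apply/eqP; rewrite -[_ == _]/(p * q %| n)%N Gauss_dvd// pn.
  - move: pn qn => /dvdnP[m ->]; rewrite mulnC => qn.
    rewrite fp; first by ring.
    by apply: contra qn => /dvdn_mull; apply.
  - move: qn pn => /dvdnP[m ->]; rewrite mulnC => pn.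
    rewrite fq; first by ring.
    by apply: contra pn => /dvdn_mull; apply.
  - rewrite f1; first by ring.
    by rewrite coprimeMr ![coprime n _]coprime_sym !prime_coprime// pn.
have pkl : p%:R ^+ k != p%:R ^+ l :> rat.
  by rewrite -!natrX eqr_nat eqn_exp2l//; apply/eqP.
(* [relk] and [rell] are the vanishing of the bilinear form at [(p ^ -k, q ^ -k)] and
   [(p ^ -l, q ^ -l)], cleared of denominators. *)
have [|| c1 [c2 [e0 e1 e2 e3]]] := bilinear_two_zeros (y := q%:R ^+ k)
  (w := q%:R ^+ l) (a0 := f' 1%N) (a1 := a1) (a2 := a2) (a3 := a3) pkl.
- by rewrite -[RHS]relk /a1 /a2 /a3; ring.
- by rewrite -[RHS]rell /a1 /a2 /a3; ring.
exists c1, c2 => s s1; rewrite Lf'.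
rewrite (Lseries_gcd (c0 := ratr (f' 1%N)) (c1 := ratr a1) (c2 := ratr a2)
  (c3 := ratr a3) s1 p0 q0); last first.
  by move=> n; rewrite fE 3!rmorphD /= !(fun_if ratr) !rmorph0.
rewrite e0 e1 e2 e3 !(rmorphN, rmorphD, rmorphM, rmorphXn) /= !rmorph_nat.
by congr (_ * _); field; rewrite !rpowc_neq0// ltr0n.
Qed.
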